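(* Let $\mathbb{K}$ be an algebraically closed field with a (Krull) valuation $\mathrm{val}:\mathbb{K}\to\Gamma\cup\{\infty\}$ onto a totally ordered abelian group $\Gamma$ together with $\infty$. Let $N\ge 1$ and let $f\in\mathbb{K}[x_1,x_1^{-1},\ldots,x_N,x_N^{-1}]$ be a non-zero Laurent polynomial. Then the tropical hypersurface associated to $f$ is equal to the hypersurface associated to the tropicalization of $f$, that is, $$\mathbf{TV}f=\mathcal{V}(\mathcal{T}f)\quad\text{as subsets of }\Gamma^N.$$
   Context: A totally ordered group is an abelian group $(\Gamma,+)$ with a total order such that $x\le y$ implies $x+z\le y+z$. Its min-plus algebra is $\mathbb{G}=\Gamma\cup\{\infty\}$ with $a\oplus b=\min\{a,b\}$, $a\odot b=a+b$, $a\oplus\infty=a$, $a\odot\infty=\infty$ (with $\infty$ larger than every element of $\Gamma$). A valuation on a field $\mathbb{K}$ with group of values $\Gamma$ is a surjective map $\mathrm{val}:\mathbb{K}\to\Gamma\cup\{\infty\}$ such that $\mathrm{val}(x)=\infty\iff x=0$, $\mathrm{val}(xy)=\mathrm{val}(x)+\mathrm{val}(y)$, and $\mathrm{val}(x+y)\ge\min\{\mathrm{val}(x),\mathrm{val}(y)\}$. On $\mathbb{K}^N$, $\mathrm{val}$ is applied coordinatewise. A non-zero Laurent polynomial is written $f=\sum_{\alpha\in\mathcal{E}(f)}\varphi_\alpha x^\alpha$ with $\mathcal{E}(f)\subset\mathbb{Z}^N$ finite and non-empty and all $\varphi_\alpha\in\mathbb{K}\setminus\{0\}$. Its tropicalization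 is the tropical polynomial $\mathcal{T}f=\bigoplus_{\alpha\in\mathcal{E}(f)}\mathrm{val}(\varphi_\alpha)\odot x^\alpha$, inducing the map $\Gamma^N\to\Gamma$, $\gamma\mapsto\min_{\alpha\in\mathcal{E}(f)}\left(\mathrm{val}(\varphi_\alpha)+\alpha_1\gamma_1+\cdots+\alpha_N\gamma_N\right)$. For $\gamma\in\Gamma^N$, let $\mathcal{D}_\gamma(\mathcal{T}f)$ be the set of $\alpha\in\mathcal{E}(f)$ at which this minimum is attained. The hypersurface associated to $\mathcal{T}f$ is $\mathcal{V}(\mathcal{T}f)=\{\gamma\in\Gamma^N : \#\mathcal{D}_\gamma(\mathcal{T}f)>1\}$. The set of zeroes of $f$ is $\mathbf{V}(f)=\{x\in(\mathbb{K}\setminus\{0\})^N : f(x)=0\}$, and the tropical hypersurface associated to $f$ is $\mathbf{TV}f=\{\mathrm{val}(x): x\in\mathbf{V}(f)\}\subset\Gamma^N$. *)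

(* Defs.v *)
From HB Require Import structures.
From mathcomp Require Import all_boot all_order all_algebra.
From mathcomp Require Import finmap.
From mathcomp Require Import classical_sets.

Set Implicit Arguments.
Unset Strict Implicit.
Unset Printing Implicit Defensive.

Import Order.TTheory GRing.Theory Num.Theory.

Local Open Scope fset_scope.
Local Open Scope classical_set_scope.
Local Open Scope ring_scope.

(* Totality is a field rather than inherited from [Order.Total]: the join of
   [Order.Total] with [GRing.Zmodule] below [Num.RealDomain] is missing from the
   hierarchy, and HB refuses to add it afterwards. *)
HB.mixin Record POrderedZmodule_isTotallyOrdered G
    of Num.POrderedZmodule G := {
  og_le_total : total (<=%R : rel G);
  og_leD2r : forall x y z : G, x <= y -> x + z <= y + z
}.

#[short(type="orderedGroupType")]
HB.structure Definition OrderedGroup :=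
  { G of Num.POrderedZmodule G & POrderedZmodule_isTotallyOrdered G }.

(* The min-plus algebra of G: [None] is the point at infinity. *)
Definition minplus (G : orderedGroupType) : Type := option G.

Section MinPlus.
Variable G : orderedGroupType.
Implicit Types a b : minplus G.

Definition tinf : minplus G := None.
Definition tfin (g : G) : minplus G := Some g.

Definition tle a b : bool :=
  match a, b with
  | _, None => true
  | None, Some _ => false
  | Some x, Some y => x <= y
  end.

Definition tadd a b : minplus G :=
  match a, b with
  | None, _ => b
  | _, None => a
  | Some x, Some y => Some (Order.min x y)
  end.

Definition tmul a b : minplus G :=
  match a, b with
  | Some x, Some y => Some (x + y)
  | _, _ => None
  end.

End MinPlus.

Record valuation (K : fieldType) (G : orderedGroupType) := Valuation {
  valf :> K -> minplus G;
  valf_inf : forall x, valf x = tinf G <-> x = 0;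
  valfM : forall x y, valf (x * y) = tmul (valf x) (valf y);
  valfD : forall x y, tle (tadd (valf x) (valf y)) (valf (x + y));
  valf_surj : forall a, exists x, valf x = a
}.

(* A Laurent polynomial in N variables is its finitely supported family of
   coefficients, indexed by the exponents in Z^N; its set of exponents is
   [finsupp]. A tropical polynomial is encoded in the same way, the coefficient
   of a missing monomial being infinity. *)
Definition laurent (K : fieldType) (N : nat) :=
  {fsfun 'rV[int]_N -> K with 0}.

Definition tropical_poly (G : orderedGroupType) (N : nat) :=
  {fsfun 'rV[int]_N -> minplus G with tinf G}.

Section Laurent.
Variables (K : fieldType) (N : nat).

Definition laurent_eval (f : laurent K N) (x : 'rV[K]_N) : K :=
  \sum_(alpha <- finsupp f) f alpha * \prod_(i < N) x ord0 i ^ alpha ord0 i.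

Definition zeroes (f : laurent K N) : set 'rV[K]_N :=
  [set x : 'rV[K]_N | (forall i, x ord0 i != 0) /\ laurent_eval f x = 0].

End Laurent.

Section Tropical.
Variables (G : orderedGroupType) (N : nat).
Implicit Types (P : tropical_poly G N) (gamma : 'rV[G]_N) (alpha : 'rV[int]_N).

Definition tmonom P gamma alpha : minplus G :=
  tmul (P alpha) (tfin (\sum_(i < N) gamma ord0 i *~ alpha ord0 i)).

Definition trop_eval P gamma : minplus G :=
  \big[@tadd G/tinf G]_(alpha <- finsupp P) tmonom P gamma alpha.

Definition trop_argmin P gamma : {fset 'rV[int]_N} :=
  [fset alpha in finsupp P | tmonom P gamma alpha == trop_eval P gamma].

Definition trop_hypersurface P : set 'rV[G]_N :=
  [set gamma : 'rV[G]_N | (1 < #|` trop_argmin P gamma|)%N].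

End Tropical.

Section Tropicalization.
Variables (K : fieldType) (G : orderedGroupType) (v : valuation K G) (N : nat).

Definition tropicalization (f : laurent K N) : tropical_poly G N :=
  [fsfun alpha in finsupp f => v (f alpha) | tinf G].

Definition TV (f : laurent K N) : set 'rV[G]_N :=
  [set gamma : 'rV[G]_N | exists2 x : 'rV[K]_N, zeroes f x & map_mx v x = map_mx (@tfin G) gamma].

End Tropicalization.

(* Main.v *)
Require Import Defs.
From mathcomp Require Import all_boot all_order all_algebra.
From mathcomp Require Import finmap.
From mathcomp Require Import classical_sets.
From mathcomp Require Import zify.

(** If [x] is a zero of [f], the terms of [f(x)] cannot have a unique one of
    least valuation, so [TV f] is contained in the tropical hypersurface.

    Conversely let the minimum at [gamma] be attained twice, and choose [c] with
    [val c = gamma]. Substituting [x_i = c_i t^(B^i)] for large [B] sends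
    distinct exponents of [f] to distinct powers of [t], so, up to a power of
    [t], [f(x)] becomes a univariate polynomial whose minimal coefficient
    valuation is attained twice. Such a polynomial has a root of valuation [0]:
    a product of factors [X - r] with [val r <> 0] has exactly one coefficient
    of least valuation. *)

Set Implicit Arguments.
Unset Strict Implicit.
Unset Printing Implicit Defensive.

Import Order.TTheory GRing.Theory Num.Theory.

Local Open Scope fset_scope.
Local Open Scope classical_set_scope.
Local Open Scope ring_scope.

(** * Order and finite sums in the min-plus algebra *)

Section MinPlusTheory.
Variable G : orderedGroupType.
Implicit Types (g : G) (a b c : minplus G).

Definition tlt a b : bool := ~~ tle b a.

Lemma tle_refl a : tle a a.
Proof. by case: a => //= x. Qed.

Lemma tle_trans b a c : tle a b -> tle b c -> tle a c.
Proof. by case: a b c => [x|] [y|] [z|] //=; apply: le_trans. Qed.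

Lemma tle_total a b : tle a b || tle b a.
Proof. by case: a b => [x|] [y|] //=; apply: og_le_total. Qed.

Lemma tle_anti a b : tle a b -> tle b a -> a = b.
Proof.
by case: a b => [x|] [y|] //= xy yx; congr Some; apply: le_anti; rewrite xy yx.
Qed.

Lemma tltW a b : tlt a b -> tle a b.
Proof. by rewrite /tlt => /negbTE h; have := tle_total a b; rewrite h orbF. Qed.

Lemma tle_lt_trans b a c : tle a b -> tlt b c -> tlt a c.
Proof. by move=> ab; apply: contra => ca; apply: tle_trans ca ab. Qed.

Lemma tlt_le_trans b a c : tlt a b -> tle b c -> tlt a c.
Proof. by move=> ab bc; apply: contra ab => ca; apply: tle_trans bc ca. Qed.

Lemma tlt_neq a b : tle a b -> a <> b -> tlt a b.
Proof. by move=> ab nab; apply/negP => ba; apply: nab; apply: tle_anti. Qed.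

Lemma tadd_min a b : tadd a b = if tle a b then a else b.
Proof.
case: a b => [x|] [y|] //=.
rewrite /Order.min lt_neqAle.
by case: (eqVneq x y) => [->|_] /=; rewrite ?lexx //; case: ifP.
Qed.

Lemma tle_tadd c a b : tle c (tadd a b) = tle c a && tle c b.
Proof.
rewrite tadd_min; case: ifPn => ab.
  by case: (boolP (tle c a)) => //= ca; rewrite (tle_trans ca ab).
have ba := tltW ab.
by case: (boolP (tle c b)) => [cb|_]; rewrite ?andbF // (tle_trans cb ba).
Qed.

(** A finite factor can be cancelled by translating by [- g]; an infinite one would send both sides
    to infinity. *)
Lemma tle_tmul2l g a b :
  tle (tmul (tfin g) a) (tmul (tfin g) b) = tle a b.
Proof.
case: a b => [x|] [y|] //=; apply/idP/idP => h.
  by have := og_leD2r _ _ (- g) h; rewrite ![g + _]addrC !addrK.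
by rewrite ![g + _]addrC og_leD2r.
Qed.

Lemma tle_bigtadd (I : eqType) (s : seq I) (F : I -> minplus G) i :
  i \in s -> tle (\big[@tadd G/tinf G]_(j <- s) F j) (F i).
Proof.
elim: s => //= j s IHs; rewrite inE big_cons.
have := tle_refl (tadd (F j) (\big[@tadd G/tinf G]_(j <- s) F j)).
rewrite tle_tadd => /andP[h1 h2] /orP[/eqP -> //|/IHs].
exact: tle_trans.
Qed.

Lemma bigtadd_attained (I : eqType) (s : seq I) (F : I -> minplus G) i0 :
  i0 \in s -> exists2 i, i \in s & F i = \big[@tadd G/tinf G]_(j <- s) F j.
Proof.
elim: s i0 => //= j s IHs i0 _; rewrite big_cons tadd_min.
case: ifPn => [_|]; first by exists j; rewrite ?mem_head.
case: s IHs => [_ |k s IHs _]; first by rewrite big_nil; case: (F j).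
have [i si <-] := IHs k (mem_head k s).
by exists i; rewrite // inE si orbT.
Qed.

(** A totally ordered group has no 2-torsion: if [g = - g], then translating [0 <= g] or [g <= 0] by
    [- g] gives the opposite inequality. *)
Lemma og_addrr_eq0 g : g + g = 0 -> g = 0.
Proof.
move=> gg; have gN : g = - g by apply/eqP; rewrite -addr_eq0 gg.
have/orP[h|h] := og_le_total 0 g; have := og_leD2r _ _ (- g) h;
  rewrite add0r subrr -gN => h'; apply: le_anti; rewrite h h' //.
Qed.

End MinPlusTheory.

(** * Elementary properties of valuations *)

Section ValuationTheory.
Variables (K : fieldType) (G : orderedGroupType) (v : valuation K G).
Implicit Types (x y : K) (a : minplus G).

Lemma valf0 : v 0 = tinf G.
Proof. exact/valf_inf. Qed.

Lemma valf_fin x : x != 0 -> exists g, v x = tfin g.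
Proof.
by case E: (v x) => [g|]; [exists g | move/valf_inf: E => ->; rewrite eqxx].
Qed.

Lemma valf1 : v 1 = tfin 0.
Proof.
have [g Eg] := valf_fin (oner_neq0 K).
have := valfM v 1 1; rewrite mulr1 Eg => -[h].
by rewrite [g](_ : _ = 0) //; apply: (addrI g); rewrite addr0.
Qed.

(** Since (-1)(-1) = 1, the value of -1 doubles to 0, so it is 0 by the absence of 2-torsion. *)
Lemma valfN x : v (- x) = v x.
Proof.
have N1 : v (- 1) = tfin 0.
  have /valf_fin[g Eg] : (- 1 : K) != 0 by rewrite oppr_eq0 oner_neq0.
  have := valfM v (- 1) (- 1); rewrite mulrNN mulr1 valf1 Eg => -[/esym h].
  by rewrite (og_addrr_eq0 h).
by rewrite -mulN1r valfM N1; case: (v x) => //= y; rewrite add0r.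
Qed.

Lemma valfD_ge a x y : tle a (v x) -> tle a (v y) -> tle a (v (x + y)).
Proof.
by move=> ax ay; apply: tle_trans (valfD v x y); rewrite tle_tadd ax.
Qed.

Lemma valfD_gt a x y : tlt a (v x) -> tlt a (v y) -> tlt a (v (x + y)).
Proof.
move=> ax ay; apply: (tlt_le_trans _ (valfD v x y)).
by rewrite tadd_min; case: ifP.
Qed.

(** If [x + y] had larger valuation than [x], then so would [x = (x + y) - y]. *)
Lemma valfD_eq x y : tlt (v x) (v y) -> v (x + y) = v x.
Proof.
move=> xy; apply: tle_anti; last by rewrite valfD_ge ?tle_refl ?tltW.
apply/negPn/negP => h; have := valfD_gt h (y := - y).
by rewrite valfN addrK => /(_ xy); rewrite /tlt tle_refl.
Qed.

(** Finiteness of [a] covers the empty sum, whose valuation is infinite. *)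
Lemma valf_sum_gt (I : eqType) (s : seq I) (F : I -> K) a :
    a <> tinf G -> (forall i, i \in s -> tlt a (v (F i))) ->
  tlt a (v (\sum_(i <- s) F i)).
Proof.
move=> a_fin aF; rewrite big_seq.
apply: (big_ind (fun x => tlt a (v x))) => //; last exact: valfD_gt.
by rewrite valf0; case: a a_fin {aF}.
Qed.

Lemma valfX x n g : v x = tfin g -> v (x ^+ n) = tfin (g *+ n).
Proof.
move=> Eg; elim: n => [|n IHn]; first by rewrite expr0 valf1.
by rewrite exprS valfM Eg IHn mulrS.
Qed.

Lemma valfV x g : v x = tfin g -> v x^-1 = tfin (- g).
Proof.
move=> Eg; have x0 : x != 0.
  by apply/eqP => E; move: Eg; rewrite E valf0.
have [h Eh] := valf_fin (invr_neq0 x0).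
have := valfM v x x^-1; rewrite divff // valf1 Eg Eh => -[/esym gh].
by rewrite (_ : h = - g) //; apply/eqP; rewrite -addr_eq0 addrC gh.
Qed.

Lemma valfXz x (n : int) g : v x = tfin g -> v (x ^ n) = tfin (g *~ n).
Proof.
case: n => n Eg; first exact: valfX.
by rewrite NegzE -exprnN mulrNz; apply/valfV/valfX.
Qed.

Lemma valf_prod (I : Type) (s : seq I) (F : I -> K) (g : I -> G) :
    (forall i, v (F i) = tfin (g i)) ->
  v (\prod_(i <- s) F i) = tfin (\sum_(i <- s) g i).
Proof.
move=> Fg; elim: s => [|i s IHs]; first by rewrite !big_nil valf1.
by rewrite !big_cons valfM Fg IHs.
Qed.

(** * Roots of valuation 0 and coefficients of least valuation *)

Definition uniq_min_coef (p : {poly K}) :=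
  exists2 j, p`_j != 0 & forall i, i != j -> tlt (v p`_j) (v p`_i).

(** The new coefficients are [p_(i-1) - r p_i]. If [r] has positive valuation, the shifted copy of
    [p] dominates and the minimum moves from [j] to [j.+1]; if negative, the copy scaled by [r]
    dominates and the minimum stays at [j]. *)
Lemma uniq_min_coefMXsubC (p : {poly K}) r :
  v r <> tfin 0 -> uniq_min_coef p -> uniq_min_coef (p * ('X - r%:P)).
Proof.
move=> r0 [j pj0 pj].
have coefE i : (p * ('X - r%:P))`_i.+1 = p`_i - r * p`_i.+1.
  by rewrite mulrBr coefB coefMX coefMC mulrC.
have coefE0 : (p * ('X - r%:P))`_0 = - (r * p`_0).
  by rewrite mulrBr coefB coefMX coefMC mulrC sub0r.
have [g Eg] := valf_fin pj0.
have pjW i : tle (v p`_j) (v p`_i).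
  by case: (eqVneq i j) => [->|/pj /tltW //]; apply: tle_refl.
have [r_gt0|r_lt0] := boolP (tle (tfin 0) (v r)).
  have {}r_gt0 : tlt (tfin 0) (v r) by apply: tlt_neq => // /esym.
  have Mr i : tlt (v p`_j) (v (r * p`_i)).
    rewrite valfM; case E: (v p`_i) => [h|]; last first.
      by rewrite Eg; case: (v r).
    apply: (@tle_lt_trans _ (tfin h)); first by rewrite -[tfin h]E.
    rewrite /tlt; case: (v r) r_gt0 => //= s s_gt0.
    apply: contra s_gt0 => /= sh.
    by have := og_leD2r _ _ (- h) sh; rewrite addrK subrr.
  have vj : v (p * ('X - r%:P))`_j.+1 = v p`_j.
    by rewrite coefE valfD_eq // valfN.
  exists j.+1 => [|[|i]].
  - by apply/eqP => E; move: vj; rewrite E valf0 Eg.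
  - by rewrite coefE0 vj valfN.
  rewrite eqSS vj coefE => ij.
  by apply: valfD_gt; rewrite ?valfN; [apply: pj | apply: Mr].
(* Negative valuation excludes infinity, so multiplication by [r] shifts all valuations by a finite
   [s] and preserves strict inequalities. *)
case E: (v r) r_lt0 => [s|] //= s_lt0.
have Mr i : v (r * p`_i) = tmul (tfin s) (v p`_i) by rewrite valfM E.
have rj i : tlt (v (r * p`_j)) (v p`_i).
  apply: tlt_le_trans (pjW i); rewrite Mr Eg /=.
  apply: contra s_lt0 => /= h.
  by have := og_leD2r _ _ (- g) h; rewrite addrK subrr.
have vj : v (p * ('X - r%:P))`_j = v (r * p`_j).
  (* The constant coefficient has no shifted term, hence the separate case [j = 0]. *)
  case: j pj0 pj Eg pjW rj => [|j] *; first by rewrite coefE0 valfN.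
  by rewrite coefE addrC valfD_eq ?valfN.
exists j => [|[|i] ij].
- by apply/eqP => h; move: vj; rewrite h valf0 Mr Eg.
- by rewrite vj coefE0 valfN !Mr /tlt tle_tmul2l; apply: pj.
rewrite vj coefE; apply: valfD_gt => //.
by rewrite valfN !Mr /tlt tle_tmul2l; apply: pj.
Qed.

End ValuationTheory.

Lemma root_valf0 (K : closedFieldType) (G : orderedGroupType)
    (v : valuation K G) (p : {poly K}) :
    p != 0 -> ~ uniq_min_coef v p ->
  exists2 t, root p t & v t = tfin 0.
Proof.
move=> p0 np; have [rs Ep] := closed_field_poly_normal p.
have [/hasP[t rst /eqP vt]|/hasPn nrs] :=
  boolP (has (fun t => v t == tfin 0) rs).
  exists t => //; rewrite Ep rootZ ?lead_coef_eq0 //.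
  by rewrite root_prod_XsubC.
case: np; rewrite Ep.
have : lead_coef p != 0 by rewrite lead_coef_eq0.
move: (lead_coef p) => l l0 {Ep p0 p}.
(* Induction on the roots, starting from the nonzero constant [l], whose other coefficients all have
   infinite valuation. *)
elim: rs nrs => [|r rs IHrs] nrs.
  exists 0%N; rewrite big_nil alg_polyC coefC ?eqxx // => -[//|i _].
  by rewrite coefC /= valf0; have [g ->] := valf_fin v l0.
rewrite big_cons mulrC scalerAl; apply: uniq_min_coefMXsubC.
  by apply/eqP/nrs; rewrite mem_head.
by apply: IHrs => t rst; apply: nrs; rewrite inE rst orbT.
Qed.

(** * Encoding exponent vectors in base [B] *)

Lemma base_expansion_inj (B N : nat) (d e : 'I_N -> nat) :
    (forall i, (d i < B)%N) -> (forall i, (e i < B)%N) ->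
    (\sum_(i < N) d i * B ^ i = \sum_(i < N) e i * B ^ i)%N ->
  d =1 e.
Proof.
elim: N d e => [|N IHN] d e dB eB; first by move=> _ [].
have split (h : 'I_N.+1 -> nat) : (\sum_(i < N.+1) h i * B ^ i =
    (\sum_(i < N) h (lift ord0 i) * B ^ i) * B + h ord0)%N.
  rewrite big_ord_recl expn0 muln1 addnC big_distrl /=; congr addn.
  by apply: eq_bigr => i _; rewrite /bump /= add1n expnSr mulnA.
rewrite !split => E.
have B0 : (0 < B)%N by apply: leq_ltn_trans (dB ord0).
(* Reduction modulo [B] isolates the lowest digit; cancelling it and dividing by [B] leaves
   expansions with one digit fewer. *)
have E0 : d ord0 = e ord0.
  by have := congr1 (modn^~ B) E; rewrite !modnMDl !modn_small.
move/eqP: E; rewrite E0 eqn_add2r eqn_pmul2r // => /eqP E i.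
have {}IHN := IHN (d \o lift ord0) (e \o lift ord0) _ _ E.
by case: (unliftP ord0 i) => [j|] -> //; apply: IHN => k /=.
Qed.

Lemma exponents_bounded (N : nat) (s : seq 'rV[int]_N) :
  exists M : nat, forall alpha, alpha \in s ->
    forall i, (`|alpha ord0 i| <= M)%N.
Proof.
exists (\max_(alpha <- s) \max_(i < N) `|alpha ord0 i|)%N => alpha salpha i.
apply: leq_trans (leq_bigmax_seq _ salpha isT).
exact: (leq_bigmax (F := fun i => `|alpha ord0 i|%N)).
Qed.

(** * Terms of [f] and tropical monomials *)

Section Monomials.
Variables (K : fieldType) (G : orderedGroupType) (v : valuation K G) (N : nat).
Variables (f : laurent K N).
Implicit Types (x : 'rV[K]_N) (gamma : 'rV[G]_N) (alpha : 'rV[int]_N).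

(** No exponent is lost, because a nonzero coefficient has finite valuation. *)
Lemma finsupp_tropicalization : finsupp (tropicalization v f) = finsupp f.
Proof.
apply/fsetP => alpha; rewrite mem_finsupp fsfunE.
case: (boolP (alpha \in finsupp f)) => [|_]; last by rewrite eqxx.
by rewrite mem_finsupp => /(valf_fin v)[g ->].
Qed.

Lemma valf_monom x gamma alpha :
    (forall i, v (x ord0 i) = tfin (gamma ord0 i)) ->
  v (f alpha * \prod_(i < N) x ord0 i ^ alpha ord0 i)
  = tmonom (tropicalization v f) gamma alpha.
Proof.
move=> xg; rewrite valfM /tmonom fsfunE.
rewrite (valf_prod _ (g := fun i => gamma ord0 i *~ alpha ord0 i)); last first.
  by move=> i; apply: valfXz.
(* Off the support both sides are infinite: the default coefficient is 0 in [f] and infinity in its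
   tropicalization. *)
by case: finsuppP => // _; rewrite valf0.
Qed.

Lemma trop_argminP gamma alpha :
  reflect (alpha \in finsupp f /\ forall beta, beta \in finsupp f ->
     tle (tmonom (tropicalization v f) gamma alpha)
         (tmonom (tropicalization v f) gamma beta))
    (alpha \in trop_argmin (tropicalization v f) gamma).
Proof.
rewrite !inE /= finsupp_tropicalization.
apply: (iffP andP) => -[sa].
  move=> /eqP ->; split=> // beta sb.
  rewrite /trop_eval finsupp_tropicalization.
  exact: (tle_bigtadd (tmonom _ gamma)).
move=> min_a; split=> //; apply/eqP; rewrite /trop_eval finsupp_tropicalization.
apply: tle_anti; last exact: (tle_bigtadd (tmonom _ gamma)).
have [b sb <-] := bigtadd_attained (tmonom (tropicalization v f) gamma) sa.
exact: min_a.
Qed.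

Lemma trop_argmin_neq0 gamma : finsupp f <> fset0 ->
  exists alpha, alpha \in trop_argmin (tropicalization v f) gamma.
Proof.
move=> hf; have [//|[a0 s0]] := fset_0Vmem (finsupp f).
have [a sa Ea] := bigtadd_attained (tmonom (tropicalization v f) gamma) s0.
exists a; apply/trop_argminP; split=> // b sb; rewrite Ea.
exact: (tle_bigtadd (tmonom _ gamma)).
Qed.

End Monomials.

(** * The two inclusions *)

Lemma cardfs_gt1P (T : choiceType) (A : {fset T}) :
  reflect (exists x y, [/\ x \in A, y \in A & x != y]) (1 < #|` A|)%N.
Proof.
rewrite cardfE; apply: (iffP card_gt1P) => [[x [y [_ _ xy]]]|[x [y [xA yA xy]]]].
  by exists (val x), (val y); split=> //; apply: fsvalP.
by exists [` xA], [` yA].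
Qed.

Lemma TV_sub_trop_hypersurface (K : fieldType) (G : orderedGroupType)
    (v : valuation K G) (N : nat) (f : laurent K N) :
    finsupp f <> fset0 ->
  TV v f `<=` trop_hypersurface (tropicalization v f).
Proof.
move=> hf gamma [x [x0 fx0] vx].
have xg i : v (x ord0 i) = tfin (gamma ord0 i).
  by move/rowP/(_ i): vx; rewrite !mxE.
have [a /[dup] aA /trop_argminP[sa min_a]] := trop_argmin_neq0 v gamma hf.
(* Suppose the minimum is attained only at [a]; all other terms then have strictly larger
   valuation. *)
apply: contraT => A1.
have lt_a b : b \in finsupp f -> b != a ->
    tlt (tmonom (tropicalization v f) gamma a)
        (tmonom (tropicalization v f) gamma b).
  move=> sb ba; apply: contra A1 => b_le_a; apply/cardfs_gt1P.
  exists b, a; split=> //; apply/trop_argminP; split=> // c sc.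
  exact: tle_trans b_le_a (min_a c sc).
have a_fin : tmonom (tropicalization v f) gamma a <> tinf G.
  rewrite -(valf_monom f a xg) => /valf_inf/eqP.
  rewrite mulf_eq0 -[f a == 0]negbK -mem_finsupp sa /= => /prodf_eq0[i _].
  by rewrite expfz_eq0 (negPf (x0 i)) andbF.
pose F b := f b * \prod_(i < N) x ord0 i ^ b ord0 i.
have F_gt b : b \in rem a (finsupp f) ->
    tlt (tmonom (tropicalization v f) gamma a) (v (F b)).
  rewrite (mem_rem_uniq _ (fset_uniq _)) => /andP[ba sb].
  by rewrite (valf_monom f b xg); apply: lt_a.
have := valf_sum_gt a_fin F_gt.
(* As [f(x) = 0], the remaining terms sum to [- F a], which has exactly the minimal valuation: a
   contradiction. *)
have -> : \sum_(b <- rem a (finsupp f)) F b = - F a.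
  apply/eqP; rewrite -addr_eq0 addrC; apply/eqP; rewrite -[RHS]fx0.
  by rewrite /laurent_eval (perm_big _ (perm_to_rem sa)) big_cons.
by rewrite valfN (valf_monom f a xg) /tlt tle_refl.
Qed.

Lemma trop_hypersurface_sub_TV (K : closedFieldType) (G : orderedGroupType)
    (v : valuation K G) (N : nat) (f : laurent K N) :
  trop_hypersurface (tropicalization v f) `<=` TV v f.
Proof.
move=> gamma /cardfs_gt1P[a [b [aA bA ab]]].
case/trop_argminP: aA => sa min_a; case/trop_argminP: bA => sb min_b.
have [c cg] : exists c : 'rV[K]_N, forall i, v (c ord0 i) = tfin (gamma ord0 i).
  have [c cg] := fin_all_exists (fun i => valf_surj v (tfin (gamma ord0 i))).
  by exists (\row_i c i) => i; rewrite mxE.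
have [M bM] := exponents_bounded (finsupp f).
(* Exponents lie between [-M] and [M]; shifted by [M] they lie between 0 and [2M], so they are
   digits in base [2M + 1]. *)
pose B := M.*2.+1.
pose e (alpha : 'rV[int]_N) := (\sum_(i < N) `|(alpha ord0 i + M%:Z)%R| * B ^ i)%N.
have e_inj : {in finsupp f &, injective e}.
  move=> al be sal sbe /base_expansion_inj h; apply/rowP => i.
  have Eabs : `|(al ord0 i + M%:Z)%R|%N = `|(be ord0 i + M%:Z)%R|%N.
    apply: h => j; rewrite /B; [have := bM _ sal j | have := bM _ sbe j].
      by move: (al ord0 j) => z; lia.
    by move: (be ord0 j) => z; lia.
  move: Eabs (bM _ sal i) (bM _ sbe i).
  by move: (al ord0 i) (be ord0 i) => y z; lia.
pose u alpha := f alpha * \prod_(i < N) c ord0 i ^ alpha ord0 i.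
(* This is [f] at the point with coordinates [c_i X^(B^i)], times the power of [X] with exponent the
   sum of the [M B^i], which clears negative exponents. Injectivity of [e] keeps the terms from
   merging. *)
pose p : {poly K} := \sum_(alpha <- finsupp f) u alpha *: 'X^(e alpha).
have coefp alpha : alpha \in finsupp f -> p`_(e alpha) = u alpha.
  move=> sal; rewrite coef_sum (perm_big _ (perm_to_rem sal)) big_cons /=.
  rewrite coefZ coefXn eqxx mulr1 big_seq big1 ?addr0 // => be.
  rewrite (mem_rem_uniq _ (fset_uniq _)) => /andP[bal sbe].
  rewrite coefZ coefXn (_ : _ == _ = false) ?mulr0 //.
  by apply: contraNF bal => /eqP/e_inj ->.
have coefp0 j : p`_j != 0 -> exists2 alpha, alpha \in finsupp f & j = e alpha.
  move=> pj; have [/hasP[al sal /eqP]|/hasPn nj] :=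
    boolP (has (fun al => j == e al) (finsupp f)); first by exists al.
  case/eqP: pj; rewrite coef_sum big_seq big1 // => al sal.
  by rewrite coefZ coefXn (negPf (nj _ sal)) mulr0.
have vu alpha : v (u alpha) = tmonom (tropicalization v f) gamma alpha.
  exact: valf_monom.
have c0 i : c ord0 i != 0.
  by apply/eqP => E; have := cg i; rewrite E valf0.
(* At least one of the minimizers [a] and [b] differs from any supposed unique one. *)
have np : ~ uniq_min_coef v p.
  case=> j /coefp0[al sal ->] lt_al.
  have no d : d \in finsupp f -> d != al ->
      tle (v (u d)) (v (u al)) -> False.
    move=> sd dal le_d; have : e d != e al by apply: contra dal => /eqP/e_inj ->.
    by move/lt_al; rewrite !coefp // /tlt le_d.
  have [Ea|na] := eqVneq a al.
    by apply: (no b); rewrite -?Ea 1?eq_sym ?vu ?min_b.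
  by apply: (no a) => //; rewrite !vu min_a.
have p0 : p != 0.
  apply/eqP => p0; have := coefp a sa; rewrite p0 coef0 => /esym/eqP.
  rewrite mulf_eq0 -[f a == 0]negbK -mem_finsupp sa /= => /prodf_eq0[i _].
  by rewrite expfz_eq0 (negPf (c0 i)) andbF.
have [t /rootP pt0 vt] := root_valf0 p0 np.
have t0 : t != 0 by apply/eqP => E; move: vt; rewrite E valf0.
(* Since [t] has valuation 0, this point has the same valuation as [c], namely [gamma]. *)
pose x : 'rV[K]_N := \row_i (c ord0 i * t ^+ (B ^ i)).
have xE i : x ord0 i = c ord0 i * t ^+ (B ^ i) by rewrite mxE.
exists x; last first.
  apply/rowP => i; rewrite !mxE valfM cg (valfX _ vt).
  by rewrite mul0rn /tmul /= addr0.
split=> [i|]; first by rewrite xE mulf_neq0 ?expf_neq0.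
(* Multiplying by this nonzero power of [t] turns [f(x)] into [p(t)], term by term. *)
apply: (mulIf (x := t ^+ (\sum_(i < N) M * B ^ i)%N)); first exact: expf_neq0.
rewrite mul0r -[RHS]pt0 /laurent_eval horner_sum mulr_suml.
rewrite big_seq [RHS]big_seq; apply: eq_bigr => al sal.
rewrite hornerZ hornerXn /u -!mulrA; congr (_ * _).
rewrite -!prodrXr -!big_split /=; apply: eq_bigr => i _.
rewrite xE expfzMl -mulrA; congr (_ * _).
rewrite !exprnP exprz_exp -expfzDr //; congr (_ ^ _).
have /gez0_abs h : 0 <= al ord0 i + M%:Z by have := bM _ sal i; move: (al ord0 i) => z; lia.
by rewrite !PoszM h mulrDl mulrC.
Qed.

Theorem theorem8p1 (K : closedFieldType) (G : orderedGroupType)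
  (v : valuation K G) (N : nat) (hN : (1 <= N)%N) (f : laurent K N)
  (hf : finsupp f <> fset0) :
  TV v f = trop_hypersurface (tropicalization v f).
Proof.
apply/seteqP; split; first exact: TV_sub_trop_hypersurface.
exact: trop_hypersurface_sub_TV.
Qed.
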